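(* Let $m,\ell,q$ be non-negative integers satisfying $m+1\ge q>0$ and $\ell\ge q+1$, let $a,b$ be complex numbers, and let $F(x)$ be the formal power series determined by $$F(x)=\frac{x^m}{1-ax^q-bx^\ell F(x)}.$$ Then for all integers $n\ge 0$, \begin{align*} H_{(n+1)(m+\ell)}(F)&=(-1)^{(n+1)\left[\binom{m+1}{2}+\binom{\ell-1}{2}\right]}\,b^{(n+1)(n\ell+nm+\ell-1)},\\ H_{n(m+\ell)+m+1}(F)&=(-1)^{(n+1)\binom{m+1}{2}+n\binom{\ell-1}{2}}\,b^{n^2(\ell+m)+n(m+1)}, \end{align*} and $H_N(F)=0$ for every positive integer $N$ that is not of the form $(n+1)(m+\ell)$ or $n(m+\ell)+m+1$ with $n\ge 0$.
   Context: For a formal power series $A(x)=\sum_{n\ge 0}a_nx^n$, the Hankel determinant is $H_N(A)=\det(a_{i+j})_{0\le i,j\le N-1}$ for $N\ge 1$, and $H_0(A)=1$ by convention. Powers use the convention $0^0=1$. *)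

(* Defs.v *)
From mathcomp Require Import all_boot all_order all_algebra.
From mathcomp Require Import reals complex.

Set Implicit Arguments.
Unset Strict Implicit.
Unset Printing Implicit Defensive.

Import GRing.Theory.
Local Open Scope ring_scope.

(* A formal power series is its sequence of coefficients: A n = [x^n] A.     *)
Definition fps (K : Type) := nat -> K.

Section FormalPowerSeries.
Variable K : fieldType.
Implicit Types A B : fps K.

Definition fps_X (n : nat) : fps K := fun k => (k == n)%:R.

Definition fps_scale (c : K) A : fps K := fun n => c * A n.

Definition fps_sub A B : fps K := fun n => A n - B n.

Definition fps_mul A B : fps K := fun n => \sum_(i < n.+1) A i * B (n - i)%N.

(* The coefficients 0, ..., n of the inverse of A. Only meaningful when      *)
(* A 0 != 0, see fps_mulfV.                                                  *)
Fixpoint fps_inv_seq A (n : nat) : seq K :=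
  if n is n'.+1 then
    let s := fps_inv_seq A n' in
    rcons s (- (A 0%N)^-1 * \sum_(i < n) A i.+1 * s`_(n' - i))
  else [:: (A 0%N)^-1].

Definition fps_inv A : fps K := fun n => (fps_inv_seq A n)`_n.

Definition fps_div A B : fps K := fps_mul A (fps_inv B).

(* Hankel A 0 = 1 by det_mx00. *)
Definition Hankel A (N : nat) : K := \det (\matrix_(i < N, j < N) A (i + j)%N).

(* x^m / (1 - a x^q - b x^l F); when 0 < q and 0 < l the denominator has     *)
(* constant term 1.                                                          *)
Definition fps_den (l q : nat) (a b : K) (F : fps K) : fps K :=
  fps_sub (fps_sub (fps_X 0) (fps_scale a (fps_X q)))
          (fps_scale b (fps_mul (fps_X l) F)).

Definition fps_rhs (m l q : nat) (a b : K) (F : fps K) : fps K :=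
  fps_div (fps_X m) (fps_den l q a b F).

Lemma size_fps_inv_seq A n : size (fps_inv_seq A n) = n.+1.
Proof. by elim: n => //= n IHn; rewrite size_rcons IHn. Qed.

Lemma nth_fps_inv_seq A n k : (k <= n)%N -> (fps_inv_seq A n)`_k = fps_inv A k.
Proof.
elim: n => [|n IHn]; first by rewrite leqn0 => /eqP ->.
rewrite leq_eqVlt => /predU1P[-> //|]; rewrite ltnS => lekn.
by rewrite /= nth_rcons size_fps_inv_seq ltnS lekn IHn.
Qed.

Lemma fps_invS A n :
  fps_inv A n.+1 =
  - (A 0%N)^-1 * \sum_(i < n.+1) A i.+1 * fps_inv A (n - i)%N.
Proof.
rewrite {1}/fps_inv /= nth_rcons size_fps_inv_seq ltnn eqxx; congr (_ * _).
by apply: eq_bigr => i _; rewrite nth_fps_inv_seq ?leq_subr.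
Qed.

Lemma fps_mulfV A : A 0%N != 0 -> fps_mul A (fps_inv A) =1 fps_X 0.
Proof.
move=> A0 [|n]; rewrite /fps_mul /fps_X.
  by rewrite big_ord_recl big_ord0 addr0 /= /fps_inv /= mulfV.
rewrite big_ord_recl /= fps_invS mulrA mulrN mulfV // mulN1r addrC.
by apply/eqP; rewrite subr_eq0; apply/eqP/eq_bigr => i _.
Qed.

Lemma eq_fps_inv A B n :
  (forall k, (k <= n)%N -> A k = B k) -> fps_inv A n = fps_inv B n.
Proof.
elim/ltn_ind: n => -[|n] IHn eqAB; first by rewrite /fps_inv /= eqAB.
rewrite !fps_invS eqAB //; congr (_ * _); apply: eq_bigr => i _.
rewrite eqAB ?ltnS ?leq_ord //; congr (_ * _).
apply: IHn => [|k lek]; first by rewrite ltnS leq_subr.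
by apply: eqAB; rewrite (leq_trans lek) // (leq_trans (leq_subr _ _)).
Qed.

Lemma fps_den0 l q a b F : (0 < q)%N -> (0 < l)%N -> fps_den l q a b F 0%N = 1.
Proof.
case: q l => [|q] [|l] // _ _.
rewrite /fps_den /fps_sub /fps_scale /fps_mul /fps_X big_ord_recl big_ord0 /=.
by rewrite mul0r addr0 !mulr0 !subr0.
Qed.

Lemma eq_fps_rhs m l q a b F G n :
    (0 < l)%N -> (forall k, (k < n)%N -> F k = G k) ->
  fps_rhs m l q a b F n = fps_rhs m l q a b G n.
Proof.
move=> l_gt0 eqFG; apply: eq_bigr => i _; congr (_ * _).
apply: eq_fps_inv => k lek; congr (_ - _ * _); apply: eq_bigr => -[j ltjk] _ /=.
rewrite /fps_X; case: eqP => [jl|_]; last by rewrite !mul0r.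
congr (_ * _); apply: eqFG; apply: leq_trans (leq_trans lek (leq_subr i n)).
by rewrite ltn_subrL jl l_gt0 (leq_trans l_gt0) // -jl -ltnS.
Qed.

(* The equation F = x^m / (1 - a x^q - b x^l F) determines F. *)
Lemma fps_rhs_unique m l q a b F G :
    (0 < l)%N -> F =1 fps_rhs m l q a b F -> G =1 fps_rhs m l q a b G ->
  F =1 G.
Proof.
move=> l_gt0 EF EG; elim/ltn_ind=> n IHn.
by rewrite EF EG; apply: eq_fps_rhs.
Qed.

Lemma fps_rhs_exists m l q a b :
  (0 < l)%N -> exists F, F =1 fps_rhs m l q a b F.
Proof.
move=> l_gt0; pose P := fps_rhs m l q a b; pose I k := iter k P (fps_X 0).
have stab n k k' : (n < k)%N -> (n < k')%N -> I k n = I k' n.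
  elim/ltn_ind: n k k' => n IHn [|k] [|k'] //; rewrite !ltnS => lek lek'.
  apply: eq_fps_rhs => // j ltjn.
  by apply: IHn => //; apply: leq_trans ltjn _.
exists (fun n => I n.+1 n) => n; apply: eq_fps_rhs => // k ltkn.
exact: stab.
Qed.

End FormalPowerSeries.

(* Main.v *)
Require Import Defs.
From mathcomp Require Import all_boot all_order all_algebra.
From mathcomp Require Import reals complex.
From mathcomp Require Import zify.

(** Put [D = 1 - a x^q - b x^l F] and [U = 1 / D], so that [F = x^m U]. The
    companion series [G = x^(l-2) U] has the same denominator, and the equation
    for [F] reads both
      [D = 1 - a x^q - x^(m+2) (b G)]   and   [D = 1 - a x^q - x^l (b F)].

    The engine is a duality for an arbitrary series [D] with constant term [1]
    ([Hankel_shift_inv]): the Hankel determinant of order [d + 1 + M] of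
    [x^d / D] is, up to the sign [(-1)^binom(d+1, 2)], the Hankel determinant of
    order [M] of minus the tail of [D] that starts at degree [d + 2]. To see it,
    multiply the Hankel matrix on both sides by the unitriangular Toeplitz
    matrix of [D]. In terms of two-variable generating functions, the Hankel
    matrix of [A = x^d / D] is [(x A(x) - y A(y)) / (x - y)], hence the product
    is [(x^(d+1) D(y) - y^(d+1) D(x)) / (x - y)], and the latter is block
    diagonal: an antitriangular block of order [d + 1] with ones on the
    antidiagonal, then the Hankel matrix of the negated tail.

    The condition [q <= m + 1] keeps [a x^q] out of the tail relevant to
    [d = m], and [q + 1 <= l] keeps it out of the one relevant to [d = l - 2].
    The duality thus exchanges [F] and [G] up to powers of [b], and two
    applications give
      [H_(m+l+K)(F) = sign * b^(l-1+2K) * H_K(F)],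
    from which everything follows by induction. The zeros come from the orders
    [1, ..., d] of [x^d U], where the Hankel matrix has a zero first row. *)

Set Implicit Arguments.
Unset Strict Implicit.
Unset Printing Implicit Defensive.

Import GRing.Theory.
Local Open Scope ring_scope.

(** * Hankel determinants of [x^d / V] *)

Section HankelDuality.
Variable K : fieldType.
Implicit Types (A U V : fps K) (c : K).

Lemma fps_mulXE d U n :
  fps_mul (fps_X K d) U n = if (d <= n)%N then U (n - d)%N else 0.
Proof.
rewrite /fps_mul /fps_X; case: leqP => [ledn | ltnd]; last first.
  by apply: big1 => -[i /= lti] _; rewrite (_ : i == d = false) ?mul0r //; lia.
have ltd : (d < n.+1)%N by [].
rewrite (bigD1 (Ordinal ltd)) //= eqxx mul1r big1 ?addr0 // => i neq.
rewrite (_ : (i : nat) == d = false) ?mul0r //.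
by apply: contraNF neq => /eqP E; apply/eqP/val_inj.
Qed.

Lemma fps_mulXA d U V n :
  fps_mul (fps_mul (fps_X K d) U) V n = fps_mul (fps_X K d) (fps_mul U V) n.
Proof.
rewrite fps_mulXE; case: leqP => [ledn | ltnd]; last first.
  apply: big1 => -[i /= lti] _; rewrite fps_mulXE.
  by rewrite (_ : (d <= i)%N = false) ?mul0r //; lia.
rewrite {1}/fps_mul.
rewrite -(big_mkord xpredT (fun i => fps_mul (fps_X K d) U i * V (n - i)%N)).
rewrite (@big_cat_nat _ _ _ d) //=; last lia.
rewrite big_nat big1 ?add0r => [|i /andP[_ lti]]; last first.
  by rewrite fps_mulXE leqNgt lti mul0r.
rewrite -{1}(add0n d) big_addn subSn // big_mkord.
apply: eq_bigr => -[i /= lti] _.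
rewrite fps_mulXE leq_addl addnK; congr (_ * V _); lia.
Qed.

Lemma eq_Hankel A B N : A =1 B -> Hankel A N = Hankel B N.
Proof.
by move=> eqAB; congr (\det _); apply/matrixP => i j; rewrite !mxE eqAB.
Qed.

Lemma Hankel_scale c A N : Hankel (fps_scale c A) N = c ^+ N * Hankel A N.
Proof.
by rewrite /Hankel -detZ; congr (\det _); apply/matrixP => i j; rewrite !mxE.
Qed.

Lemma Hankel_mulX_eq0 d U N :
  (0 < N <= d)%N -> Hankel (fps_mul (fps_X K d) U) N = 0.
Proof.
case: N => // N ltNd; rewrite /Hankel (expand_det_row _ ord0) big1 // => j _.
by rewrite !mxE fps_mulXE leqNgt (leq_trans (ltn_ord j) ltNd) mul0r.
Qed.

(** The entries of [T *m H *m T^T], where [T] is the infinite lower triangular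
    Toeplitz matrix of [V] and [H] the infinite Hankel matrix of [A]. *)
Definition toeplitz_conj V A i j : K :=
  \sum_(s < i.+1) V (i - s)%N * \sum_(t < j.+1) V (j - t)%N * A (s + t)%N.

(** Under the conjugation, each side of the Hankel shift identity
    [H i j.+1 = H i.+1 j] picks up one boundary term, from the longer of its two
    sums. For the generating function [C(x, y)] of the conjugated matrix this
    says [(x - y) C(x, y) = x A(x) V(x) V(y) - y A(y) V(x) V(y)]. *)
Lemma toeplitz_conjS V A i j :
  toeplitz_conj V A i.+1 j + V j.+1 * fps_mul A V i
    = toeplitz_conj V A i j.+1 + V i.+1 * fps_mul A V j.
Proof.
rewrite {1}/toeplitz_conj big_ord_recl /= subn0.
have -> : \sum_(t < j.+1) V (j - t)%N * A (0 + t)%N = fps_mul A V j.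
  by apply: eq_bigr => t _; rewrite add0n mulrC.
rewrite -addrA addrC; congr (_ + _).
rewrite /toeplitz_conj mulr_sumr -big_split; apply: eq_bigr => s _ /=.
rewrite [in RHS]big_ord_recl /= subn0 addn0 mulrDr addrC; congr (_ + _).
  by rewrite mulrA mulrC.
congr (_ * _); apply: eq_bigr => t _.
by rewrite /bump /= !add1n addSn addnS subSS.
Qed.

(** The coefficients of [(x^(d+1) V(y) - y^(d+1) V(x)) / (x - y)]. *)
Definition dual_block d V i j : K :=
  if (i <= d)%N && (j <= d)%N then
    if (d <= i + j)%N then V (i + j - d)%N else 0
  else if (d < i)%N && (d < j)%N then - V (i + j - d)%N else 0.

(** A matrix is determined by its first row and the defect of the Hankel shift
    identity, so it is enough to compare those. *)
Lemma toeplitz_conjE d V A i j :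
    V 0%N = 1 -> fps_mul A V =1 fps_X K d ->
  toeplitz_conj V A i j = dual_block d V i j.
Proof.
move=> V0 AV; elim: i j => [|i IHi] j.
  rewrite /toeplitz_conj big_ord_recl big_ord0 addr0 V0 mul1r.
  under eq_bigr do rewrite add0n mulrC.
  rewrite -/(fps_mul A V j) AV /dual_block /fps_X leq0n ltn0 add0n /=.
  by case: (ltngtP j d) => // ->; rewrite subnn V0.
apply/(addIr (V j.+1 * fps_mul A V i)); rewrite toeplitz_conjS IHi !AV.
rewrite /dual_block /fps_X addnS addSn.
case: (ltngtP i d) => [ltid|ltdi|->]; case: (ltngtP j d) => [ltjd|ltdj|->] /=;
  rewrite ?mulr0 ?mulr1 ?addr0 ?add0r ?leqnn ?ltnn //=.
- by rewrite ltnNge ltid.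
- by rewrite -addSn addnK ifT ?leq_addl.
- by rewrite andbF ltnNge ltjd.
- by rewrite !ltnS (ltnW ltdi) (ltnW ltdj).
- by rewrite -addSn addnK andbF addNr.
- by rewrite -addnS addKn leq_addr add0r.
- by rewrite -addnS addKn addNr.
- by rewrite add0r.
Qed.

Lemma det_toeplitz V N : V 0%N = 1 ->
  \det (\matrix_(i < N, j < N) (if (j <= i)%N then V (i - j)%N else 0)) = 1.
Proof.
move=> V0; rewrite det_trig; last first.
  by apply/is_trig_mxP => i j ltij; rewrite mxE leqNgt ltij.
by apply: big1 => i _; rewrite mxE leqnn subnn.
Qed.

Lemma sum_toeplitz V N (i : 'I_N) (f : nat -> K) :
  \sum_(k < N) (if (k <= i)%N then V (i - k)%N else 0) * f k
    = \sum_(s < i.+1) V (i - s)%N * f s.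
Proof.
rewrite (big_ord_widen N (fun s => V (i - s)%N * f s) (ltn_ord i)).
rewrite [RHS]big_mkcond; apply: eq_bigr => k _; rewrite ltnS.
by case: ifP => // _; rewrite mul0r.
Qed.

Lemma Hankel_toeplitz_conj V A N : V 0%N = 1 ->
  Hankel A N = \det (\matrix_(i < N, j < N) toeplitz_conj V A i j).
Proof.
move=> V0.
pose T := \matrix_(i < N, j < N) (if (j <= i)%N then V (i - j)%N else 0).
have -> : \matrix_(i < N, j < N) toeplitz_conj V A i j
          = T *m ((\matrix_(i < N, j < N) A (i + j)%N) *m T^T).
  apply/matrixP => i j; rewrite !mxE /toeplitz_conj.
  rewrite -(sum_toeplitz V i
    (fun s => \sum_(t < j.+1) V (j - t)%N * A (s + t)%N)).
  apply: eq_bigr => s _; rewrite !mxE; congr (_ * _).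
  rewrite -(sum_toeplitz V j (fun t => A (s + t)%N)) /=.
  by apply: eq_bigr => t _; rewrite !mxE mulrC.
by rewrite !det_mulmx det_tr det_toeplitz // mul1r mulr1.
Qed.

Lemma det_antitrig d V : V 0%N = 1 ->
  \det (\matrix_(i < d.+1, j < d.+1)
          (if (d <= i + j)%N then V (i + j - d)%N else 0))
    = (-1) ^+ 'C(d.+1, 2).
Proof.
move=> V0; elim: d => [|d IHd].
  by rewrite det_mx11 mxE leq0n V0.
(* Only the last entry of the first row is nonzero. *)
rewrite (expand_det_row _ ord0) (bigD1 ord_max) //= big1 ?addr0; last first.
  move=> j neqj; rewrite mxE add0n leqNgt ifF ?mul0r //.
  have : (j : nat) != d.+1 by apply: contra neqj => /eqP E; apply/eqP/val_inj.
  by have := ltn_ord j; lia.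
rewrite mxE add0n leqnn subnn V0 mul1r /cofactor add0n binS bin1 exprD mulrC.
rewrite -IHd; congr (\det _ * _); apply/matrixP => i j; rewrite !mxE.
by rewrite lift0 lift_max addSn ltnS subSS.
Qed.

(** One level of a continued fraction: if [V = p - x^(d+2) W] with [p] of degree
    at most [d + 1], then passing from [x^d / V] to the remainder [W] lowers the
    order by [d + 1]. The coefficients of [p] other than [p(0) = 1] only occur
    strictly beyond the antidiagonal of the first diagonal block, so they do not
    influence the determinant. *)
Theorem Hankel_shift_inv d U V M :
    V 0%N = 1 -> fps_mul U V =1 fps_X K 0 ->
  Hankel (fps_mul (fps_X K d) U) (d.+1 + M)
    = (-1) ^+ 'C(d.+1, 2) * Hankel (fun k => - V (k + d.+2)%N) M.
Proof.
move=> V0 UV; rewrite (Hankel_toeplitz_conj _ _ V0).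
have XUV : fps_mul (fps_mul (fps_X K d) U) V =1 fps_X K d.
  move=> n; rewrite fps_mulXA fps_mulXE UV /fps_X.
  by case: ltngtP => [ltdn|//|->]; rewrite ?subnn // subn_eq0 leqNgt ltdn.
rewrite -(det_antitrig d V0) /Hankel -(det_ublock _ 0); congr (\det _).
apply/matrixP => i j; rewrite mxE (toeplitz_conjE _ _ V0 XUV) /dual_block.
case: (split_ordP i) => i' ->; case: (split_ordP j) => j' ->.
- by rewrite block_mxEul mxE /= !leq_ord.
- rewrite block_mxEur mxE /= (leqNgt (d.+1 + j')) leq_addr andbF.
  by rewrite (ltnNge d i') leq_ord.
- rewrite block_mxEdl mxE /= (leqNgt (d.+1 + i')) leq_addr.
  by rewrite (ltnNge d j') leq_ord andbF.
- rewrite block_mxEdr mxE /= (leqNgt (d.+1 + i')) !leq_addr /=.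
  congr (- V _); lia.
Qed.

End HankelDuality.

(** * The series defined by the quadratic equation *)

Section QuadraticSeries.
Variables (K : fieldType) (m l q : nat) (a b : K) (F : fps K).
Hypotheses (hq : (0 < q <= m + 1)%N) (hl : (q + 1 <= l)%N).
Hypothesis hF : F =1 fps_rhs m l q a b F.

Let D := fps_den l q a b F.
Let U := fps_inv D.
Let G := fps_mul (fps_X K (l - 2)) U.

Let D0 : D 0%N = 1.
Proof. by apply: fps_den0; lia. Qed.

Let UD : fps_mul U D =1 fps_X K 0.
Proof.
move=> n; rewrite -(@fps_mulfV _ D) ?D0 ?oner_eq0 // /fps_mul.
rewrite (reindex_inj rev_ord_inj); apply: eq_bigr => -[i /= lti] _.
by rewrite subSS subKn // mulrC.
Qed.

(** Beyond degree [q] only the term [b x^l F] of the denominator is left. *)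
Let denE k : (q < k)%N -> - D k = b * (if (l <= k)%N then F (k - l)%N else 0).
Proof.
move=> ltqk; rewrite /D /fps_den /fps_sub /fps_scale fps_mulXE /fps_X.
have /negPf -> : k != 0%N by lia.
have /negPf -> : k != q by lia.
by rewrite mulr0 subr0 sub0r opprK.
Qed.

(** The term [a x^q] of the denominator has degree less than [m + 2], so the
    tail seen by the duality is [b G]. *)
Lemma Hankel_F_dual M :
  Hankel F (m.+1 + M) = (-1) ^+ 'C(m.+1, 2) * (b ^+ M * Hankel G M).
Proof.
rewrite (eq_Hankel _ hF) (Hankel_shift_inv _ _ D0 UD) -Hankel_scale.
congr (_ * _); apply: eq_Hankel => k; rewrite denE /fps_scale; last lia.
congr (_ * _); rewrite /G fps_mulXE hF /fps_rhs /fps_div fps_mulXE -/D -/U.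
case: (leqP (l - 2) k) => le2k.
  by rewrite !ifT; [congr (U _)|..]; lia.
by case: ifP => // lel; rewrite ifF //; lia.
Qed.

Lemma Hankel_G_dual M :
  Hankel G (l.-1 + M) = (-1) ^+ 'C(l.-1, 2) * (b ^+ M * Hankel F M).
Proof.
have El : l.-1 = (l - 2).+1 by lia.
rewrite El (Hankel_shift_inv _ _ D0 UD) -Hankel_scale.
congr (_ * _); apply: eq_Hankel => k; rewrite denE /fps_scale; last lia.
by rewrite ifT; [congr (_ * F _)|]; lia.
Qed.

(** The duality for [d = m] followed by the one for [d = l - 2]. *)
Lemma Hankel_F_period N :
  Hankel F (m + l + N)
    = (-1) ^+ ('C(m + 1, 2) + 'C(l - 1, 2)) * b ^+ (l - 1 + N + N)
      * Hankel F N.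
Proof.
have -> : (m + l + N = m.+1 + (l.-1 + N))%N by lia.
rewrite Hankel_F_dual Hankel_G_dual addn1 subn1.
move: 'C(_, 2) 'C(_, 2) => s t; rewrite !exprD -!mulrA; congr (_ * _).
by rewrite [RHS]mulrCA; congr (_ * _); rewrite mulrCA.
Qed.

Lemma Hankel_F_full n :
  Hankel F ((n + 1) * (m + l))
    = (-1) ^+ ((n + 1) * ('C(m + 1, 2) + 'C(l - 1, 2)))
      * b ^+ ((n + 1) * (n * l + n * m + l - 1)).
Proof.
elim: n => [|n IHn].
  rewrite -[((0 + 1) * (m + l))%N]addn0 add0n mul1n Hankel_F_period.
  rewrite /Hankel det_mx00 mulr1 mul1n; congr (_ * b ^+ _); lia.
have -> : ((n.+1 + 1) * (m + l) = m + l + (n + 1) * (m + l))%N by lia.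
rewrite Hankel_F_period IHn mulrACA -!exprD.
by congr (_ ^+ _ * _ ^+ _); nia.
Qed.

Lemma Hankel_F_partial n :
  Hankel F (n * (m + l) + m + 1)
    = (-1) ^+ ((n + 1) * 'C(m + 1, 2) + n * 'C(l - 1, 2))
      * b ^+ (n ^ 2 * (l + m) + n * (m + 1)).
Proof.
elim: n => [|n IHn].
  rewrite (_ : (0 * (m + l) + m + 1 = m.+1 + 0)%N); last lia.
  rewrite Hankel_F_dual /Hankel det_mx00 !addn1 !mul0n addn0 mul1n.
  by rewrite !mulr1 addn0.
have -> : (n.+1 * (m + l) + m + 1 = m + l + (n * (m + l) + m + 1))%N by lia.
rewrite Hankel_F_period IHn mulrACA -!exprD !expnS expn0 !muln1.
by congr (_ ^+ _ * _ ^+ _); nia.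
Qed.

Lemma Hankel_F_eq0 N :
    (0 < N)%N ->
    ~ (exists n : nat,
         N = ((n + 1) * (m + l))%N \/ N = (n * (m + l) + m + 1)%N) ->
  Hankel F N = 0.
Proof.
elim/ltn_ind: N => N IHN N0 notN.
have neq1 : N <> (m + 1)%N by move=> E; apply: notN; exists 0%N; right; lia.
have neq2 : N <> (m + l)%N by move=> E; apply: notN; exists 0%N; left; lia.
case: (leqP N m) => [leNm | ltmN].
  by rewrite (eq_Hankel _ hF) Hankel_mulX_eq0 ?N0.
case: (leqP N (m + l)) => [leN | ltN].
  have -> : N = (m.+1 + (N - m.+1))%N by lia.
  by rewrite Hankel_F_dual Hankel_mulX_eq0 ?mulr0 //; lia.
have -> : N = (m + l + (N - (m + l)))%N by lia.
rewrite Hankel_F_period IHN ?mulr0 //; try lia.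
by case=> n En; apply: notN; exists n.+1; case: En => En; [left|right]; lia.
Qed.

End QuadraticSeries.

Theorem theorem19 (R : realType) (m l q : nat) (a b : R[i]) (F : fps R[i])
    (hq : (0 < q <= m + 1)%N) (hl : (q + 1 <= l)%N)
    (hF : F =1 fps_div (fps_X R[i] m)
                 (fps_sub (fps_sub (fps_X R[i] 0) (fps_scale a (fps_X R[i] q)))
                          (fps_scale b (fps_mul (fps_X R[i] l) F)))) :
  (forall n : nat,
     Hankel F ((n + 1) * (m + l)) =
       (-1) ^+ ((n + 1) * ('C(m + 1, 2) + 'C(l - 1, 2)))
       * b ^+ ((n + 1) * (n * l + n * m + l - 1))
     /\
     Hankel F (n * (m + l) + m + 1) =
       (-1) ^+ ((n + 1) * 'C(m + 1, 2) + n * 'C(l - 1, 2))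
       * b ^+ (n ^ 2 * (l + m) + n * (m + 1)))
  /\
  (forall N : nat, (0 < N)%N ->
     ~ (exists n : nat,
          N = ((n + 1) * (m + l))%N \/ N = (n * (m + l) + m + 1)%N) ->
     Hankel F N = 0).
Proof.
split=> [n|N N0 notN].
  by split; [apply: Hankel_F_full hF n | apply: Hankel_F_partial hF n].
exact: Hankel_F_eq0 hF N N0 notN.
Qed.
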